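(* Let $p$ be a prime and $(t_n)_{n\ge1}$ a sequence of positive integers with $t_n<\log_p n+\log\log n$ for each $n$ and $\lim_{n\to\infty}(t_n-\log_p n)=\infty$. Let $A_n,B_n$ be disjoint sets of size $n$, let $\mathbf{f}_n$ be chosen uniformly at random from the set $\Omega_{A_n,B_n,t_n}$ of bijections $A_n\times[t_n]\to B_n\times[t_n]$, and let $G_n=\varphi(\mathbf{f}_n)$. Then for every $\delta>0$ there exists $n_0\in\mathbb{N}$ such that $\mathbb{P}(c(G_n)<\delta)\ge0.9$ for all $n\ge n_0$.
   Context: $\log$ is the natural logarithm, $[d]=\{1,\ldots,d\}$. A multigraph has a vertex set and an edge set, each edge having a set of two endpoints (parallel edges allowed). For a bijection $f:A\times[d]\to B\times[d]$, $\varphi(f)$ is the $d$-regular bipartite multigraph on vertex set $A\cup B$ with edge set $\{e_{a,i}:(a,i)\in A\times[d]\}$, where $e_{a,i}$ has endpoints $a$ and $b$ with $f(a,i)=(b,j)$ for some $j$. For a multigraph $G$ and $S\subseteq V(G)$, $N_G(S)$ is the set of vertices not in $S$ joined by an edge to some vertex of $S$, $N_G(v)=N_G(\{v\})$. For a bipartite multigraph $G$ with bipartition $\{A,B\}$, $|A|=|B|=n$: $\mathcal{F}_A(G)=\{S:\varnothing\ne S\subsetneq A,\ N_G(S)\ne B,\ N_G(w)\not\subseteq N_G(S)\ \forall w\in A\setminus S\}$ and $c(G)=\sum_{S\in\mathcal{F}_A(G)}p^{|S|-|N_G(S)|}$ (here with $A=A_n$, $B=B_n$). *)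

(* Defs.v *)
From HB Require Import structures.
From mathcomp Require Import all_boot all_order all_algebra.
From mathcomp Require Import boolp classical_sets reals topology normedtype exp.
Set Implicit Arguments.
Unset Strict Implicit.
Unset Printing Implicit Defensive.
Import Order.TTheory GRing.Theory Num.Theory.

Local Open Scope set_scope.

Record multigraph := Multigraph {
  vertex : finType;
  edge : finType;
  endpoints : edge -> {set vertex};
  card_endpoints : forall e, #|endpoints e| = 2
}.

Definition nbhd (G : multigraph) (S : {set vertex G}) : {set vertex G} :=
  [set v | (v \notin S) &&
           [exists u in S, exists e : edge G, endpoints e == [set u; v]]].

Definition famA (G : multigraph) (A B : {set vertex G}) : {set {set vertex G}} :=
  [set S : {set vertex G} |
    [&& S != finset.set0, S \proper A, nbhd S != B &
        [forall w in A :\: S, ~~ (nbhd [set w] \subset nbhd S)]]].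

(* The exponent |S| - |N(S)| is a difference of integers, not truncated. *)
Definition cval (R : realType) (p : nat) (G : multigraph)
    (A B : {set vertex G}) : R :=
  (\sum_(S in famA A B) (p%:R : R) ^ (#|S|%:Z - #|nbhd S|%:Z))%R.

(* The two sides A, B are finite types; their disjoint union is the type A + B,
   with the following images as the two parts of the bipartition. *)
Definition lside (A B : finType) : {set A + B} := [set inl a | a : A].
Definition rside (A B : finType) : {set A + B} := [set inr b | b : B].

Definition phi_endpoints (A B : finType) (d : nat)
    (f : {ffun A * 'I_d -> B * 'I_d}) (e : A * 'I_d) : {set A + B} :=
  [set inl e.1; inr (f e).1].

Lemma card_phi_endpoints (A B : finType) (d : nat)
    (f : {ffun A * 'I_d -> B * 'I_d}) (e : A * 'I_d) :
  #|phi_endpoints f e| = 2.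
Proof. by rewrite /phi_endpoints cards2. Qed.

Definition phi (A B : finType) (d : nat)
    (f : {ffun A * 'I_d -> B * 'I_d}) : multigraph :=
  Multigraph (card_phi_endpoints f).

Definition Omega (A B : finType) (d : nat) : {set {ffun A * 'I_d -> B * 'I_d}} :=
  [set f : {ffun A * 'I_d -> B * 'I_d} | `[< bijective f >]].

Definition unif_prob (R : realType) (T : finType) (O : {set T}) (E : pred T) : R :=
  (#|[set x in O | E x]|%:R / #|O|%:R)%R.

Definition logb (R : realType) (b : nat) (x : R) : R := (ln x / ln b%:R)%R.

(* Main.v *)
(** First moment: the mean of c(G) tends to 0, and Markov's inequality
    concludes.

    A closed set S is determined by T = B \ N(S), since S = A \ N(T), and the
    term of S equals p^(|T|-|N(T)|); so c(G) is at most the sum of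
    p^(|S|-|N(S)|) over small nonempty S in A, the same sum over small nonempty
    T in B, and p^n times the number of pairs (S, T) of large sets without an
    edge between them.  The last part has mean at most
    (4 p exp(- eps^2 d))^n, where small means of size at most eps n.

    For small S, writing p^(n-|N(S)|) as the sum of (p-1)^|T| over the T
    disjoint from N(S), and bounding the probability that S and T are not joined
    by (1-|T|/n)^(|S|d), the mean of p^(-|N(S)|) is at most the moment of order
    |S|d of Y/n, with Y binomial of parameters n and 1/p.  A moment of order k is
    at most p^(-k) exp(2pk^2/n) when k <= n/(2p), and moments decrease with their
    order, so the sum over S splits into three ranges: |S| at most of order n/d^2,
    where the sum is exp(O(n p^(-d))) - 1; then up to order n/d; then up to
    eps n. *)

Require Import Defs.
From HB Require Import structures.
From mathcomp Require Import all_boot all_order all_algebra perm.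
From mathcomp Require Import boolp reals topology normedtype sequences exp.
From mathcomp Require Import ring lra zify.
Set Implicit Arguments.
Unset Strict Implicit.
Unset Printing Implicit Defensive.
Import Order.TTheory GRing.Theory Num.Theory.

(** * Counting the bijections that send a given set into another *)

Section BijectionsAvoiding.
Variables (X Y : finType).
Hypothesis cardXY : #|X| = #|Y|.

Definition inj_into (U : {set X}) (W : {set Y}) : {set {ffun X -> Y}} :=
  [set f : {ffun X -> Y} | injectiveb f & [forall x in U, f x \in W]].

Lemma card_preimset_inj (f : {ffun X -> Y}) (W : {set Y}) :
  injective f -> #|f @^-1: W| = #|W|.
Proof.
move=> injf; apply: on_card_preimset; apply: onW_bij.
by apply: inj_card_bij injf _; rewrite cardXY.
Qed.

(* Composing with the transposition of [x] and [y] shows that every [y] outside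
   [U] is sent into [W] by equally many [f]; then count the pairs [(f, y)]. *)
Lemma card_inj_into_step (U : {set X}) (W : {set Y}) (x : X) : x \notin U ->
  (#|X| - #|U|) * #|inj_into (x |: U) W| = (#|W| - #|U|) * #|inj_into U W|.
Proof.
move=> xNU.
pose fix_at (y : X) := [set f in inj_into U W | f y \in W].
have eq_y y : y \notin U -> #|fix_at y| = #|inj_into (x |: U) W|.
  move=> yNU; pose h (f : {ffun X -> Y}) := [ffun z => f (tperm x y z)].
  have hK : involutive h by move=> f; apply/ffunP => z; rewrite !ffunE tpermK.
  rewrite -(card_preimset _ (inv_inj hK)); apply: eq_card => f.
  have tpermU z : z \in U -> tperm x y z = z.
    by move=> zU; rewrite tpermD //; [apply: contraNneq xNU => ->|apply: contraNneq yNU => ->].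
  rewrite !inE ffunE tpermR -andbA; congr andb.
    apply/injectiveP/injectiveP => injf a b.
      by have := @injf (tperm x y a) (tperm x y b); rewrite !ffunE !tpermK =>
        h1 /h1 /perm_inj.
    by rewrite !ffunE => /injf /perm_inj.
  apply/andP/forall_inP => [[/forall_inP fU fx] z|fU].
    by rewrite !inE => /predU1P[->//|zU]; have := fU z zU; rewrite ffunE tpermU.
  split; last by apply: fU; rewrite !inE eqxx.
  by apply/forall_inP => z zU; rewrite ffunE tpermU// fU// !inE zU orbT.
have : \sum_(y in ~: U) #|fix_at y| =
       \sum_(f in inj_into U W) #|[set y in ~: U | f y \in W]|.
  under eq_bigr do rewrite -sum1_card.
  under [RHS]eq_bigr do rewrite -sum1_card.
  rewrite (exchange_big_dep (mem (inj_into U W))) /=; last first.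
    by move=> y f _; rewrite inE => /andP[].
  apply: eq_bigr => f fP; apply: eq_bigl => y.
  by rewrite [LHS]andbC !inE; move: fP; rewrite !inE => ->; rewrite andbC.
rewrite (eq_bigr (fun=> #|inj_into (x |: U) W|)); last first.
  by move=> y; rewrite inE => /eq_y.
rewrite sum_nat_const cardsCs setCK => ->.
(* For a fixed [f], the preimage of [W] has the size of [W] and contains [U]. *)
rewrite (eq_bigr (fun=> #|W| - #|U|)); first by rewrite sum_nat_const mulnC.
move=> f; rewrite inE => /andP[/injectiveP injf /forall_inP fU].
rewrite -(card_preimset_inj W injf) -cardsDS; last first.
  by apply/subsetP => z zU; rewrite inE fU.
by apply: eq_card => z; rewrite !inE.
Qed.

(** Adding the points of [U] one at a time. Since [inj_into set0 W] consists of all injections, this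
    is the probability [|W| ^_ u / |X| ^_ u], with [u = |U|], cleared of denominators. *)
Lemma card_inj_into (U : {set X}) (W : {set Y}) :
  #|inj_into U W| * #|X| ^_ #|U| = #|inj_into set0 W| * #|W| ^_ #|U|.
Proof.
have [u] := ubnP #|U|; elim: u U => // u IH U.
have [->|[x xU]] := set_0Vmem U; first by rewrite cards0 !ffactn0.
rewrite (cardsD1 x) xU ltnS => /IH {}IH.
have := @card_inj_into_step (U :\ x) W x.
rewrite !inE eqxx setD1K // => /(_ isT) step.
rewrite add1n !ffactnSr [LHS]mulnCA [RHS]mulnA -IH.
rewrite [_ * (#|X| - _)]mulnC step; ring.
Qed.

(** Factor by factor, [(w - i) / (N - i) <= w / N]. *)
Lemma leq_ffact_expn (w N u : nat) : w <= N -> w ^_ u * N ^ u <= N ^_ u * w ^ u.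
Proof.
move=> wN; elim: u => [|u IH]; first by rewrite !ffactn0.
rewrite !ffactnSr !expnSr !mulnA.
rewrite [leqLHS](_ : _ = w ^_ u * N ^ u * ((w - u) * N)); last by ring.
rewrite [leqRHS](_ : _ = N ^_ u * w ^ u * ((N - u) * w)); last by ring.
by rewrite leq_mul // !mulnBl [N * w]mulnC leq_sub2l // leq_mul2l wN orbT.
Qed.

(** Both sides are [N ^_ (u + v)]; they vanish when [u + v > N]. *)
Lemma ffact_swap (N u v : nat) : u <= N -> v <= N ->
  (N - v) ^_ u * N ^_ v = (N - u) ^_ v * N ^_ u.
Proof.
move=> uN vN; have [uv|uv] := leqP (u + v) N; last first.
  by rewrite (@ffact_small (N - v)) ?(@ffact_small (N - u)) //; lia.
apply/eqP; rewrite -(eqn_pmul2r (fact_gt0 (N - u - v))); apply/eqP.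
have eC : N - v - u = N - u - v by rewrite -!subnDA addnC.
have e1 := @ffact_fact (N - v) u; have e2 := @ffact_fact (N - u) v.
rewrite mulnAC -{1}eC e1; last by lia.
rewrite [RHS]mulnAC e2; last by lia.
by rewrite mulnC ffact_fact // mulnC ffact_fact.
Qed.

Lemma card_inj_into_le (U : {set X}) (W : {set Y}) :
  #|inj_into U W| * #|X| ^ #|U| <= #|inj_into set0 W| * #|W| ^ #|U|.
Proof.
have wN : #|W| <= #|X| by rewrite cardXY max_card.
have N_gt0 : 0 < #|X| ^_ #|U| by rewrite ffact_gt0 max_card.
rewrite -(leq_pmul2r N_gt0) mulnAC card_inj_into -!mulnA leq_mul2l.
by rewrite [X in _ || (_ <= X)]mulnC leq_ffact_expn ?orbT.
Qed.

(** The probability that [U] avoids [V] is symmetric in the two sizes by [ffact_swap], so the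
    exponent may be [|V|] instead of [|U|]. *)
Lemma card_inj_into_le_dual (U : {set X}) (V : {set Y}) :
  #|inj_into U (~: V)| * #|X| ^ #|V| <=
  #|inj_into set0 (~: V)| * (#|X| - #|U|) ^ #|V|.
Proof.
have uN : #|U| <= #|X| by rewrite max_card.
have vN : #|V| <= #|X| by rewrite cardXY max_card.
have N_gt0 : 0 < #|X| ^_ #|V| by rewrite ffact_gt0.
have U_gt0 : 0 < #|X| ^_ #|U| by rewrite ffact_gt0.
have : #|inj_into U (~: V)| * #|X| ^_ #|V| =
       #|inj_into set0 (~: V)| * (#|X| - #|U|) ^_ #|V|.
  apply/eqP; rewrite -(eqn_pmul2r U_gt0); apply/eqP.
  rewrite mulnAC card_inj_into [#|~: V|]cardsCs setCK -cardXY.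
  by rewrite -mulnA ffact_swap // mulnA.
move=> E; rewrite -(leq_pmul2r N_gt0) mulnAC E -!mulnA leq_mul2l.
by rewrite [X in _ || (_ <= X)]mulnC leq_ffact_expn ?orbT // leq_subr.
Qed.

End BijectionsAvoiding.

Local Open Scope ring_scope.

(** * Binomial sums over subsets *)

Section SetSums.
Variables (R : comPzRingType) (T : finType).

Lemma sum_set_expr (x y : R) :
  \sum_(J : {set T}) x ^+ #|J| * y ^+ #|~: J| = (x + y) ^+ #|T|.
Proof.
transitivity (\prod_(i : T) (x + y)); last by rewrite prodr_const.
rewrite (bigA_distr _ _ (fun=> x) (fun=> y)) /=; apply: eq_bigr => J _.
rewrite (bigID (mem J)) /=; congr (_ * _).
  by rewrite (eq_bigr (fun=> x)) ?prodr_const// => i ->.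
rewrite (eq_bigr (fun=> y)) => [|i /negbTE ->//].
by rewrite prodr_const; congr (_ ^+ _); apply: eq_card => i; rewrite !inE.
Qed.

Lemma sum_subset_expr (C : {set T}) (x : R) :
  \sum_(J : {set T} | J \subset C) x ^+ #|J| = (1 + x) ^+ #|C|.
Proof.
transitivity (\prod_(i : T) ((if i \in C then x else 0) + 1)); last first.
  rewrite (bigID (mem C)) /= [X in _ * X]big1 ?mulr1 => [|i /negbTE ->].
    by rewrite -prodr_const; apply: eq_bigr => i ->; rewrite addrC.
  by rewrite add0r.
rewrite (bigA_distr _ _ _ (fun=> 1)) /= [RHS](bigID (fun J : {set T} => J \subset C)) /=.
rewrite [X in _ + X]big1 ?addr0 => [|J /subsetPn[i iJ iNC]]; last first.
  by rewrite (bigD1 i) //= iJ (negbTE iNC) mul0r.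
apply: eq_bigr => J /subsetP JC.
rewrite (bigID (mem J)) /= [X in _ * X]big1 ?mulr1 => [|i /negbTE ->//].
by rewrite -prodr_const; apply: eq_bigr => i iJ; rewrite iJ JC.
Qed.

Lemma sum_setT_expr (x : R) : \sum_(J : {set T}) x ^+ #|J| = (1 + x) ^+ #|T|.
Proof.
rewrite -cardsT -sum_subset_expr; apply: eq_bigl => J.
by rewrite finset.subsetT.
Qed.

End SetSums.

(** * Absence of edges in the random graph, and the mean of [p^(-|N(S)|)] *)

Section RandomGraph.
Variables (R : realType) (A B : finType) (d n : nat).
Hypotheses (cardA : #|A| = n) (cardB : #|B| = n) (n_gt0 : (0 < n)%N)
  (d_gt0 : (0 < d)%N).
Implicit Types (f : {ffun A * 'I_d -> B * 'I_d}) (S : {set A}) (T : {set B}).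

Definition nbrs f S : {set B} := [set b | [exists a in S, exists i, (f (a, i)).1 == b]].
Definition conbrs f T : {set A} := [set a | [exists i, (f (a, i)).1 \in T]].
Definition edgeless f S T : bool :=
  [forall a in S, forall i, (f (a, i)).1 \notin T].

Lemma edgelessP f S T :
  reflect (forall a i, a \in S -> (f (a, i)).1 \notin T) (edgeless f S T).
Proof.
apply: (iffP forall_inP) => [h a i /h /forallP|h a aS]; first exact.
by apply/forallP => i; apply: h.
Qed.

Lemma edgeless_nbrs f S T : edgeless f S T = (T \subset ~: nbrs f S).
Proof.
apply/edgelessP/subsetP => [h b bT|h a i aS].
  rewrite !inE; apply/exists_inP => -[a aS /existsP[i /eqP fb]].
  by have := h a i aS; rewrite fb bT.
apply: contraTN isT => /h; rewrite !inE => /exists_inP[]; exists a => //.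
by apply/existsP; exists i.
Qed.

Lemma edgeless_conbrs f S T : edgeless f S T = (S \subset ~: conbrs f T).
Proof.
apply/edgelessP/subsetP => [h a aS|h a i /h].
  by rewrite !inE; apply/existsP => -[i]; apply/negP/h.
by rewrite !inE => /existsPn.
Qed.

Let cardX : #|{: A * 'I_d}| = (n * d)%N.
Proof. by rewrite card_prod card_ord cardA. Qed.
Let cardY : #|{: B * 'I_d}| = (n * d)%N.
Proof. by rewrite card_prod card_ord cardB. Qed.
Let cardXY : #|{: A * 'I_d}| = #|{: B * 'I_d}|.
Proof. by rewrite cardX cardY. Qed.

Lemma in_Omega f : (f \in Omega A B d) = injectiveb f.
Proof.
rewrite inE; apply/asboolP/injectiveP => [/bij_inj//|injf].
by apply: inj_card_bij injf _; rewrite cardXY.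
Qed.

Lemma Omega_inj_into W : Omega A B d = inj_into finset.set0 W.
Proof.
apply/setP => f; rewrite in_Omega inE andbC.
by case: forall_inP => // -[] x; rewrite inE.
Qed.

Lemma edgeless_inj_into S T : [set f in Omega A B d | edgeless f S T] =
  inj_into (setX S [set: 'I_d]) (~: setX T [set: 'I_d]).
Proof.
apply/setP => f; rewrite inE in_Omega inE; congr andb.
apply/edgelessP/forall_inP => [h [a i]|h a i aS].
  by rewrite !inE /= andbT => aS; rewrite andbT h.
by have := h (a, i); rewrite !inE /= !andbT => /(_ aS).
Qed.

Lemma Omega_gt0 : (0 < #|Omega A B d|)%N.
Proof.
apply/card_gt0P; exists [ffun x => enum_val (cast_ord cardXY (enum_rank x))].
rewrite in_Omega; apply/injectiveP => x y; rewrite !ffunE.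
by move=> /enum_val_inj /cast_ord_inj /enum_rank_inj.
Qed.

Let cardSd S : #|setX S [set: 'I_d]| = (#|S| * d)%N.
Proof. by rewrite cardsX cardsT card_ord. Qed.
Let cardTd T : #|setX T [set: 'I_d]| = (#|T| * d)%N.
Proof. by rewrite cardsX cardsT card_ord. Qed.

(** Passage to the reals, where [d] cancels from [(n * d - m * d) / (n * d)]. *)
Let ratioE (m P O e : nat) : (m <= n)%N ->
  (P * (n * d) ^ e <= O * (n * d - m * d) ^ e)%N ->
  P%:R <= O%:R * (1 - m%:R / n%:R) ^+ e :> R.
Proof.
move=> mn; rewrite -mulnBl -(ler_nat R) !natrM !natrX !natrM natrB //.
have nd0 : (0 : R) < (n%:R * d%:R) ^+ e by rewrite exprn_gt0 // mulr_gt0 ?ltr0n.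
rewrite -ler_pdivlMr // => /le_trans; apply.
rewrite -mulrA -expr_div_n ler_wpM2l // le_eqVlt; apply/orP; left; apply/eqP.
congr (_ ^+ _); field.
by rewrite !pnatr_eq0 -!lt0n n_gt0 d_gt0.
Qed.

Lemma card_edgeless_le S T : (#|[set f in Omega A B d | edgeless f S T]|)%:R <=
  #|Omega A B d|%:R * (1 - #|T|%:R / n%:R) ^+ (#|S| * d) :> R.
Proof.
have Tn : (#|T| <= n)%N by rewrite -cardB max_card.
apply: ratioE => //; rewrite edgeless_inj_into.
rewrite (Omega_inj_into (~: setX T [set: 'I_d])).
have := card_inj_into_le cardXY (setX S [set: 'I_d]) (~: setX T [set: 'I_d]).
by rewrite [#|~: _|]cardsCs finset.setCK cardX cardY cardSd cardTd.
Qed.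

Lemma card_edgeless_le_dual S T : (#|[set f in Omega A B d | edgeless f S T]|)%:R <=
  #|Omega A B d|%:R * (1 - #|S|%:R / n%:R) ^+ (#|T| * d) :> R.
Proof.
have Sn : (#|S| <= n)%N by rewrite -cardA max_card.
apply: ratioE => //; rewrite edgeless_inj_into.
rewrite (Omega_inj_into (~: setX T [set: 'I_d])).
have := card_inj_into_le_dual cardXY (setX S [set: 'I_d]) (setX T [set: 'I_d]).
by rewrite cardX cardSd cardTd.
Qed.

Variable p : nat.
Hypothesis p_gt0 : (0 < p)%N.

(** [C] is the side containing the neighbourhood, and [e] will be the number of edges leaving the
    given set. *)
Definition mean_weight (C : finType) (e : nat) : R :=
  p%:R ^- #|C| * \sum_(T : {set C}) (p%:R - 1) ^+ #|T| * (1 - #|T|%:R / #|C|%:R) ^+ e.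

Let expr_compl (C : finType) (D : {set C}) :
  (p%:R : R) ^- #|D| = p%:R ^- #|C| * \sum_(T : {set C} | T \subset ~: D) (p%:R - 1) ^+ #|T|.
Proof.
rewrite sum_subset_expr addrC subrK -(cardsC D) exprD invfM -mulrA.
by rewrite mulVf ?mulr1 // expf_neq0 // pnatr_eq0 -lt0n.
Qed.

(** Stated for an abstract neighbourhood [N] in [C], so as to serve both sides: expand [p^(-|N f|)]
    by [expr_compl], exchange the sums, and bound each event [s D]. *)
Let mean_le (C : finType) (N : {ffun A * 'I_d -> B * 'I_d} -> {set C})
    (s : {set C} -> pred {ffun A * 'I_d -> B * 'I_d}) e :
  (forall f (D : {set C}), s D f = (D \subset ~: N f)) ->
  (forall D, (#|[set f in Omega A B d | s D f]|)%:R <=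
    #|Omega A B d|%:R * (1 - #|D|%:R / #|C|%:R) ^+ e :> R) ->
  \sum_(f in Omega A B d) p%:R ^- #|N f| <= #|Omega A B d|%:R * mean_weight C e.
Proof.
move=> sE s_le; under eq_bigr do rewrite expr_compl.
rewrite -mulr_sumr /mean_weight mulrCA ler_wpM2l ?invr_ge0 ?exprn_ge0 //.
rewrite (exchange_big_dep predT) //= mulr_sumr; apply: ler_sum => D _.
rewrite sumr_const -[leLHS]mulr_natr mulrCA ler_wpM2l ?exprn_ge0 ?subr_ge0 ?ler1n //.
apply: le_trans (s_le D); rewrite ler_nat subset_leq_card //.
by apply/subsetP => f; move=> fD; rewrite finset.in_set sE.
Qed.

Lemma mean_nbrs_le S : \sum_(f in Omega A B d) p%:R ^- #|nbrs f S| <=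
  #|Omega A B d|%:R * mean_weight B (#|S| * d) :> R.
Proof.
apply: (@mean_le _ _ (fun T f => edgeless f S T)) => [f T|T].
  exact: edgeless_nbrs.
by rewrite cardB card_edgeless_le.
Qed.

(** Here the fixed set is on the side of [B], so the exponent must be [|T| * d]: this is where the
    dual count enters. *)
Lemma mean_conbrs_le T : \sum_(f in Omega A B d) p%:R ^- #|conbrs f T| <=
  #|Omega A B d|%:R * mean_weight A (#|T| * d) :> R.
Proof.
apply: (@mean_le _ _ (fun S f => edgeless f S T)) => [f S|S].
  exact: edgeless_conbrs.
by rewrite cardA card_edgeless_le_dual.
Qed.

End RandomGraph.

(** * Moments of the binomial density, and the sum over small sets *)

Section MeanWeight.
Variables (R : realType) (p n : nat).
Hypotheses (p_gt1 : (1 < p)%N) (n_gt0 : (0 < n)%N).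

Let p_gt0 : 0 < p%:R :> R. Proof. by rewrite ltr0n ltnW. Qed.
Let n_gt0' : 0 < n%:R :> R. Proof. by rewrite ltr0n. Qed.

(** From [1 - x <= expR (- x)], because [(1 - x) (1 + x + 2 x^2) = 1 + x^2 (1 - 2 x)]. *)
Lemma expR_le_quadratic (x : R) :
  0 <= x -> x <= 1 / 2 -> expR x <= 1 + x + 2 * x ^+ 2.
Proof.
move=> x0 x1; have h := expR_ge1Dx (- x).
have -> : expR x = (expR (- x))^-1 by rewrite expRN invrK.
apply: (@le_trans _ _ (1 - x)^-1); first by rewrite lef_pV2 ?posrE ?expR_gt0 //; lra.
rewrite -div1r ler_pdivrMr; last lra.
by rewrite -subr_ge0 (_ : _ - _ = x ^+ 2 * (1 - 2 * x)); [rewrite mulr_ge0 ?sqr_ge0 //; lra|ring].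
Qed.

Lemma exprD1_le_expR (x : R) (m : nat) : 0 <= 1 + x -> (1 + x) ^+ m <= expR (m%:R * x).
Proof.
move=> x0; rewrite expRM_natl lerXn2r ?nnegrE ?expR_ge0 //.
exact: expR_ge1Dx.
Qed.

(* For [T] a random subset containing each point with probability [1 - 1/p],
   [mean_weight R p C e] is the [e]-th moment of the density of [~: T], a
   rescaled binomial variable; the bound comes from [x <= expR (x - 1)] and the
   exponential moments of the binomial law. *)
Lemma mean_weight_le (C : finType) (e k : nat) : #|C| = n -> (k <= e)%N ->
  (2 * p * k <= n)%N ->
  mean_weight R p C e <= p%:R ^- k * expR (2 * p%:R * k%:R ^+ 2 / n%:R).
Proof.
(* [x] is the exponential tilt: with [u = |~: T|], the [k]-th power of [v <= expR (v - 1)] at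
   [v = p u / n] produces the factor [z ^+ u]. *)
move=> cardC ke pkn; set x : R := p%:R * k%:R / n%:R; set z := expR x.
have x0 : 0 <= x by rewrite divr_ge0 ?mulr_ge0.
have x1 : x <= 1 / 2.
  rewrite ler_pdivrMr // -(ler_nat R) !natrM in pkn *; lra.
have termle (T : {set C}) : (1 - #|T|%:R / #|C|%:R) ^+ e <=
    p%:R ^- k * expR (- k%:R) * z ^+ #|~: T| :> R.
  have Tn : (#|T| <= n)%N by rewrite -cardC max_card.
  have -> : (1 : R) - #|T|%:R / #|C|%:R = #|~: T|%:R / n%:R.
    rewrite [#|~: T|]cardsCs finset.setCK cardC natrB // mulrBl divff //.
    by rewrite gt_eqF.
  have Un : (#|~: T| <= n)%N by rewrite -cardC max_card.
  set u := #|~: T|.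
  have u0 : 0 <= u%:R / n%:R :> R by rewrite divr_ge0.
  have u1 : u%:R / n%:R <= 1 :> R by rewrite ler_pdivrMr // mul1r ler_nat.
  apply: (@le_trans _ _ ((u%:R / n%:R) ^+ k)); first exact: ler_wiXn2l.
  have -> : p%:R ^- k * expR (- k%:R) * z ^+ u =
      (p%:R^-1 * expR (p%:R * (u%:R / n%:R) - 1)) ^+ k :> R.
    rewrite exprMn exprVn -!expRM_natl -mulrA -expRD; congr (_ * expR _).
    by rewrite /x; field; rewrite gt_eqF.
  rewrite lerXn2r ?nnegrE ?mulr_ge0 ?invr_ge0 ?expR_ge0 ?(ltW p_gt0) //.
  rewrite ler_pdivlMl //.
  by have := expR_ge1Dx (p%:R * (u%:R / n%:R) - 1 : R); rewrite addrC subrK.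
have p1 : 0 <= p%:R - 1 :> R by rewrite subr_ge0 ler1n ltnW.
apply: (@le_trans _ _ (p%:R ^- n * (p%:R ^- k * expR (- k%:R) * (p%:R - 1 + z) ^+ n))).
  rewrite /mean_weight cardC ler_pM2l ?invr_gt0 ?exprn_gt0 //.
  rewrite -[in leRHS]cardC -sum_set_expr mulr_sumr; apply: ler_sum => T _.
  by rewrite mulrCA -cardC ler_wpM2l ?exprn_ge0 // termle.
rewrite [leLHS]mulrCA -[leLHS]mulrA ler_pM2l ?invr_gt0 ?exprn_gt0 //.
rewrite -exprVn -exprMn.
have -> : p%:R^-1 * (p%:R - 1 + z) = 1 + (z - 1) / p%:R by field; rewrite gt_eqF.
have z1 : 1 <= z by rewrite -expR0 ler_expR.
have h : 0 <= 1 + (z - 1) / p%:R by rewrite addr_ge0 // divr_ge0 ?subr_ge0 ?(ltW p_gt0).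
apply: (@le_trans _ _ (expR (- k%:R) * expR (n%:R * ((z - 1) / p%:R)))).
  by rewrite ler_pM2l ?expR_gt0 // exprD1_le_expR.
rewrite -expRD ler_expR.
have : z - 1 <= x + 2 * x ^+ 2 by have := expR_le_quadratic x0 x1; rewrite -/z; lra.
(* The linear term [n x / p] is exactly [k] and cancels [- k]; the quadratic one is the error
   [2 p k^2 / n]. *)
rewrite -(ler_pM2l (divr_gt0 n_gt0' p_gt0)).
have -> : n%:R / p%:R * (x + 2 * x ^+ 2) = k%:R + 2 * p%:R * k%:R ^+ 2 / n%:R.
  by rewrite /x; field; rewrite !gt_eqF.
by rewrite mulrAC -mulrA; lra.
Qed.

(** The full order [k = s * d] is used; the hypothesis makes the error [2 p k^2 / n] at most [s]. *)
Lemma mean_weight_le_small (C : finType) (s d : nat) : #|C| = n ->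
  (2 * s * p * (d * d) <= n)%N ->
  mean_weight R p C (s * d) <= (p%:R ^- d * expR 1) ^+ s.
Proof.
move=> cardC sn.
have k_le : (2 * p * (s * d) <= n)%N.
  by apply: leq_trans sn; case: d => [|d]; rewrite ?muln0//; nia.
apply: le_trans (mean_weight_le cardC (leqnn _) k_le) _.
rewrite exprMn -expRM_natl exprVn -exprM [(d * s)%N]mulnC ler_pM2l ?invr_gt0 ?exprn_gt0 //.
rewrite ler_expR ler_pdivrMr // mulr1 natrM.
move: sn; rewrite -(ler_nat R) !natrM => sn.
have -> : 2 * p%:R * (s%:R * d%:R) ^+ 2 = s%:R * (2 * s%:R * p%:R * (d%:R * d%:R)) :> R by ring.
by rewrite ler_wpM2l.
Qed.

Lemma expR_quarter_le : expR (1 / 4) <= 4 / 3 :> R.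
Proof.
have h := expR_ge1Dx (- (1 / 4) : R).
have -> : expR (1 / 4) = (expR (- (1 / 4)))^-1 :> R by rewrite expRN invrK.
rewrite (_ : 4 / 3 = (3 / 4)^-1); last by field.
by rewrite lef_pV2 ?posrE ?expR_gt0 //; lra.
Qed.

(** Now the error is at most [k / 4], and [expR (1 / 4) / p <= 2 / 3] as [p >= 2]. *)
Lemma mean_weight_le_medium (C : finType) (e k : nat) : #|C| = n -> (k <= e)%N ->
  (8 * p * k <= n)%N -> mean_weight R p C e <= (2 / 3) ^+ k.
Proof.
move=> cardC ke kn; have k_le : (2 * p * k <= n)%N by lia.
apply: le_trans (mean_weight_le cardC ke k_le) _.
apply: (@le_trans _ _ ((p%:R^-1 * expR (1 / 4)) ^+ k)).
  rewrite exprMn -expRM_natl exprVn ler_pM2l ?invr_gt0 ?exprn_gt0 //.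
  rewrite ler_expR ler_pdivrMr //.
  move: kn; rewrite -(ler_nat R) !natrM => kn.
  have -> : 2 * p%:R * k%:R ^+ 2 = k%:R * (1 / 4) * (8 * p%:R * k%:R) :> R by field.
  by rewrite ler_wpM2l // mulr_ge0 //; lra.
have r0 : 0 <= 2 / 3 :> R by lra.
rewrite lerXn2r ?nnegrE ?[0 <= _^-1 * _]mulr_ge0 ?invr_ge0 ?expR_ge0 ?(ltW p_gt0) //.
rewrite ler_pdivrMl //; apply: le_trans expR_quarter_le _.
have : 2 <= p%:R :> R by rewrite ler_nat.
lra.
Qed.

(** One summand on the right for each range of [|S|]. Each term is bounded by something of the form
    [z ^+ |S|] times a constant, so that summing over all [S] gives [(1 + z) ^+ n]. The free
    parameter [x] plays the part of [z] in the last range, replacing a factor [2 ^+ n] by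
    [(1 + x) ^+ n]. *)
Lemma small_sum_le (C D : finType) (d : nat) (eps x : R) :
  #|C| = n -> #|D| = n -> (0 < d)%N -> 0 < x -> x <= 1 ->
  \sum_(S : {set C} | (S != finset.set0) && (#|S|%:R <= eps * n%:R))
     p%:R ^+ #|S| * mean_weight R p D (#|S| * d) <=
  (expR (n%:R * (p%:R * (p%:R ^- d * expR 1))) - 1) +
  expR (n%:R * (expR 1 * (p%:R * (2 / 3) ^+ d)) - n%:R / (2 * p%:R * d%:R ^+ 2)) +
  expR (n%:R * (x + eps * ln (p%:R / x))) * (2 / 3) ^+ (n %/ (8 * p)).
Proof.
move=> cardC cardD d_gt0 x0 x1.
set a := p%:R * (p%:R ^- d * expR 1); set y := p%:R * (2 / 3) ^+ d.
set K := (n %/ (8 * p))%N; set q := n%:R / (2 * p%:R * d%:R ^+ 2).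
have d0 : 0 < d%:R :> R by rewrite ltr0n.
have a0 : 0 <= a by rewrite !mulr_ge0 ?invr_ge0 ?exprn_ge0 ?expR_ge0 ?(ltW p_gt0).
have y0 : 0 <= y by rewrite mulr_ge0 ?exprn_ge0 ?(ltW p_gt0) //; lra.
have px1 : 1 <= p%:R / x.
  by rewrite ler_pdivlMr // mul1r (le_trans x1) // ler1n ltnW.
have r23 : 0 <= 2 / 3 :> R by lra.
have r0 : 0 <= (2 / 3) ^+ K :> R by rewrite exprn_ge0.
pose w (S : {set C}) : R := (expR 1 * y) ^+ #|S| * expR (- q) +
  x ^+ #|S| * (expR (n%:R * (eps * ln (p%:R / x))) * (2 / 3) ^+ K).
have w1 m : 0 <= (expR 1 * y) ^+ m * expR (- q).
  by rewrite mulr_ge0 ?expR_ge0 // exprn_ge0 // mulr_ge0 ?expR_ge0.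
have w2 m : 0 <= x ^+ m * (expR (n%:R * (eps * ln (p%:R / x))) * (2 / 3) ^+ K).
  by apply: mulr_ge0; [rewrite exprn_ge0 // ltW|apply: mulr_ge0; rewrite ?expR_ge0].
have w0 S : 0 <= w S by rewrite addr_ge0.
have term (S : {set C}) : #|S|%:R <= eps * n%:R ->
    p%:R ^+ #|S| * mean_weight R p D (#|S| * d) <= a ^+ #|S| + w S.
  set s := #|S| => s_eps.
  have ps0 : 0 < p%:R ^+ s :> R by rewrite exprn_gt0.
  have [le1|gt1] := leqP (2 * s * p * (d * d)) n.
    apply: le_trans (_ : a ^+ s <= _); last by rewrite lerDl.
    by rewrite exprMn ler_pM2l // mean_weight_le_small.
  have [le2|gt2] := leqP (8 * p * (s * d)) n.
    (* Past the first range [s > q], so the factor [expR (s - q) >= 1] can be inserted; it leaves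
       [expR (- q)] outside the sum over [S]. *)
    apply: (@le_trans _ _ ((expR 1 * y) ^+ s * expR (- q))); last first.
      by rewrite /w addrCA lerDl addr_ge0 // exprn_ge0.
    apply: (@le_trans _ _ (y ^+ s)).
      rewrite exprMn -exprM [(d * s)%N]mulnC ler_pM2l //.
      exact: mean_weight_le_medium.
    rewrite [(expR 1 * y) ^+ s]exprMn -expRM_natl mulr1 mulrAC -expRD ler_peMl ?exprn_ge0 //.
    rewrite -[leLHS]expR0 ler_expR subr_ge0 ler_pdivrMr; last by rewrite !mulr_gt0 ?exprn_gt0.
    move: (ltnW gt1); rewrite -(ler_nat R) !natrM => gt1R; lra.
  (* In the last range only the moment of order [K < s * d] is used, and [p^s = x^s (p / x)^s] with
     [s <= eps n] in the second factor. *)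
  apply: le_trans (_ : x ^+ s *
    (expR (n%:R * (eps * ln (p%:R / x))) * (2 / 3) ^+ K) <= _); last first.
    by rewrite /w addrA lerDr addr_ge0 // exprn_ge0.
  apply: (@le_trans _ _ (p%:R ^+ s * (2 / 3) ^+ K)).
    rewrite ler_pM2l //; apply: mean_weight_le_medium => //.
      by rewrite /K ltnW // ltn_divLR ?muln_gt0 ?(ltnW p_gt1) // mulnC.
    by rewrite /K mulnC leq_divM.
  rewrite mulrA ler_wpM2r //.
  have -> : p%:R ^+ s = x ^+ s * (p%:R / x) ^+ s by rewrite -exprMn mulrC divfK ?gt_eqF.
  rewrite ler_pM2l ?exprn_gt0 //.
  have pxp : 0 < p%:R / x by rewrite divr_gt0.
  rewrite -[X in X ^+ s]lnK ?posrE // -expRM_natl ler_expR mulrA [n%:R * eps]mulrC.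
  by rewrite ler_wpM2r ?ln_ge0.
apply: (@le_trans _ _ (\sum_(S : {set C} | S != finset.set0) a ^+ #|S| + \sum_(S : {set C}) w S)).
  apply: le_trans (ler_sum _ (fun S (hS : _ && _) => term S (andP hS).2)) _.
  rewrite big_split /= lerD //.
    rewrite [leRHS](bigID (fun S : {set C} => #|S|%:R <= eps * n%:R)) /= lerDl.
    by rewrite sumr_ge0 // => S _; rewrite exprn_ge0.
  rewrite [leRHS](bigID (fun S : {set C} => (S != finset.set0) && (#|S|%:R <= eps * n%:R))).
  by rewrite /= lerDl sumr_ge0.
rewrite -addrA lerD //.
  have := sum_setT_expr C a; rewrite (bigD1 finset.set0) //= cards0 expr0 cardC.
  move=> E; rewrite -[leLHS](addKr 1) E addrC lerB // exprD1_le_expR //.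
  by rewrite addr_ge0.
rewrite big_split /= -!mulr_suml !sum_setT_expr cardC lerD //.
  by rewrite expRD ler_wpM2r ?expR_ge0 // exprD1_le_expR // addr_ge0 // mulr_ge0 ?expR_ge0.
rewrite mulrDr expRD -mulrA; apply: ler_wpM2r; first by rewrite mulr_ge0 ?expR_ge0.
by rewrite exprD1_le_expR // addr_ge0 // ltW.
Qed.

End MeanWeight.

(** * Splitting c(G) into small sets on either side and large pairs without edges *)

Lemma ler_sum_reindex (R : numDomainType) (I J : finType) (h : I -> J)
    (P : pred I) (Q : pred J) (F : J -> R) :
  (forall j, 0 <= F j) -> {in P &, injective h} -> (forall i, P i -> Q (h i)) ->
  \sum_(i | P i) F (h i) <= \sum_(j | Q j) F j.
Proof.
move=> F0 injh hPQ; rewrite -big_set -(big_imset F); last first.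
  by move=> i j; rewrite !inE; apply: injh.
rewrite [leRHS](bigID (mem (h @: [set i | P i]))) /=.
rewrite (eq_bigl (fun j => Q j && (j \in h @: [set i | P i]))).
  by rewrite lerDl sumr_ge0.
move=> j /=; rewrite andb_idl // => /imsetP[i + ->].
by rewrite inE => /hPQ.
Qed.

Section ClosedSets.
Variables (R : realType) (A B : finType) (d n p : nat).
Hypotheses (cardA : #|A| = n) (cardB : #|B| = n) (n_gt0 : (0 < n)%N)
  (d_gt0 : (0 < d)%N) (p_gt1 : (1 < p)%N).
Implicit Types (f : {ffun A * 'I_d -> B * 'I_d}) (S : {set A}) (T : {set B}).

Let p_gt0 : 0 < p%:R :> R. Proof. by rewrite ltr0n ltnW. Qed.
Let n_gt0' : 0 < n%:R :> R. Proof. by rewrite ltr0n. Qed.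

Lemma nbhd_phi f S : nbhd (G := phi f) [set inl a | a in S] = [set inr b | b in nbrs f S].
Proof.
apply/setP => -[a|b]; rewrite !inE.
  rewrite [RHS](_ : _ = false); last by apply/negP => /imsetP[].
  apply/andP => -[_ /exists_inP[u /imsetP[a' _ ->] /existsP[e /eqP /setP]]].
  by move=> /(_ (inr (f e).1)); rewrite !inE eqxx orbT.
rewrite (_ : inr b \notin _); last by apply/negP => /imsetP[].
rewrite mem_imset; last by move=> ? ? [].
rewrite inE; apply/exists_inP/exists_inP => [[u]|[a aS /existsP[i /eqP fb]]].
  case/imsetP => a aS -> /existsP[[a' i] /eqP/setP /= E]; exists a => //.
  apply/existsP; exists i.
  move: (E (inl a')) (E (inr b)); rewrite !inE !eqxx /= ?orbF => /esym/eqP[ea] /eqP[eb].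
  by rewrite -ea eb.
exists (inl a); first exact: imset_f.
by apply/existsP; exists (a, i); rewrite /= /phi_endpoints /= fb.
Qed.

(** The last condition is closedness under the Galois connection that the relation of not being
    joined sets up between subsets of [A] and of [B]. *)
Definition closed_sets f : {set {set A}} :=
  [set S : {set A} | [&& S != finset.set0, nbrs f S != [set: B] &
    [forall w in ~: S, ~~ (nbrs f [set w] \subset nbrs f S)]]].

Definition weight f S : R := p%:R ^+ #|S| * p%:R ^- #|nbrs f S|.

Lemma weight_ge0 f S : 0 <= weight f S.
Proof. by rewrite mulr_ge0 ?invr_ge0 ?exprn_ge0. Qed.

(** Members of [famA] lie in [lside A B], so pulling back along [inl] is injective on them and lands
    in [closed_sets f]. *)
Lemma cval_le_closed f :
  cval R p (G := phi f) (lside A B) (rside A B) <= \sum_(S in closed_sets f) weight f S.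
Proof.
pose pre (S : {set A + B}) := [set a | inl a \in S].
have preK (S : {set A + B}) : S \subset lside A B -> S = [set inl a | a in pre S].
  move=> /subsetP SA; apply/setP => v; apply/idP/imsetP => [vS|[a + ->]].
    by have /imsetP[a _ va] := SA _ vS; exists a; rewrite ?inE -?va.
  by rewrite inE.
have famK (S : {set A + B}) : S \in famA (G := phi f) (lside A B) (rside A B) ->
    S = [set inl a | a in pre S].
  by rewrite inE => /and4P[_ /andP[/preK]].
apply: le_trans (_ : \sum_(S in famA (G := phi f) (lside A B) (rside A B))
    weight f (pre S) <= _).
  apply: ler_sum => S /famK SE; rewrite {1 2}SE nbhd_phi.
  rewrite !card_imset; [|by move=> ? ? []..].
  by rewrite expfzDr ?gt_eqF // /weight exprnN.
apply: ler_sum_reindex => [S||S SF]; first exact: weight_ge0.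
  by move=> S S' SF S'F E; rewrite (famK _ SF) (famK _ S'F) E.
move: (SF) (famK _ SF).
set S0 := pre S; move=> + SE; rewrite [S0 \in _]inE [S \in _]inE SE.
case/and4P => S_neq0 _ nbhdB closS.
apply/and3P; split.
- by apply: contraNneq S_neq0 => ->; rewrite imset0 eqxx.
- apply/eqP => E; case/negP: nbhdB; rewrite nbhd_phi E; apply/eqP/setP => v.
  by apply/imsetP/imsetP => -[b _ ->]; exists b; rewrite ?inE.
apply/forall_inP => w; rewrite inE => wNS.
have /(forall_inP closS) : inl w \in lside A B :\: [set inl a | a in S0].
  apply/finset.setDP; split; first exact: imset_f.
  apply/imsetP => -[a aS [wa]].
  by rewrite wa aS in wNS.
apply: contraNN => sub.
rewrite (_ : [set inl w] = [set inl a | a in [set w]]); last by rewrite imset_set1.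
by rewrite !nbhd_phi imsetS.
Qed.

(** A vertex with no neighbour outside N(S) has all its neighbours in N(S), hence lies in [S] by
    closedness. *)
Lemma closed_setsK f S : S \in closed_sets f -> ~: conbrs f (~: nbrs f S) = S.
Proof.
rewrite inE => /and3P[_ _ /forall_inP closS]; apply/setP => a; rewrite !inE.
apply/existsPn/idP => [h|aS i]; last first.
  by rewrite !inE negbK; apply/exists_inP; exists a => //; apply/existsP; exists i.
apply: contraT => aNS; have := closS a; rewrite inE => /(_ aNS)/negP[].
apply/subsetP => b; rewrite inE => /exists_inP[_ /set1P -> /existsP[i /eqP <-]].
by have := h i; rewrite inE negbK.
Qed.

(** With T = B \ N(S) and S = A \ N(T), both sides having size [n], |S| - |N(S)| = (n - |N(T)|) - (n
    - |T|). *)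
Lemma weight_dual f S : S \in closed_sets f ->
  weight f S = p%:R ^+ #|~: nbrs f S| * p%:R ^- #|conbrs f (~: nbrs f S)|.
Proof.
move=> SF; have := closed_setsK SF.
set T := ~: nbrs f S; rewrite /weight => ES.
have := cardsC (nbrs f S); rewrite -/T cardB => eB.
have := cardsC (conbrs f T); rewrite ES cardA => eA.
have pk0 k : p%:R ^+ k != 0 :> R by rewrite gt_eqF ?exprn_gt0.
apply/eqP; rewrite eqr_div //; apply/eqP; rewrite -!exprD.
by congr (_ ^+ _); lia.
Qed.

(** Closed sets are sorted into [S] small, then [S] large with [T S] small, where the weight is
    rewritten in terms of [T S], then both large. *)
Lemma cval_le f (eps : R) :
  cval R p (G := phi f) (lside A B) (rside A B) <=
  \sum_(S : {set A} | (S != finset.set0) && (#|S|%:R <= eps * n%:R))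
     p%:R ^+ #|S| * p%:R ^- #|nbrs f S| +
  \sum_(T : {set B} | (T != finset.set0) && (#|T|%:R <= eps * n%:R))
     p%:R ^+ #|T| * p%:R ^- #|conbrs f T| +
  p%:R ^+ n * \sum_(S : {set A} | eps * n%:R < #|S|%:R)
    \sum_(T : {set B} | eps * n%:R < #|T|%:R) (edgeless f S T)%:R.
Proof.
apply: le_trans (cval_le_closed f) _.
pose T S := ~: nbrs f S.
rewrite (bigID (fun S : {set A} => #|S|%:R <= eps * n%:R)) /= -[leRHS]addrA lerD //.
  apply: (@ler_sum_reindex _ _ _ id) => [S|? ? //|S].
    exact: weight_ge0.
  by rewrite inE => /andP[/and3P[-> _ _] ->].
rewrite (bigID (fun S : {set A} => #|T S|%:R <= eps * n%:R)) /= lerD //.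
  pose g (D : {set B}) : R := p%:R ^+ #|D| * p%:R ^- #|conbrs f D|.
  rewrite (eq_bigr (fun S => g (T S))); last first.
    by move=> S /andP[/andP[SF _] _]; rewrite weight_dual.
  apply: ler_sum_reindex => [D||S].
  - by rewrite mulr_ge0 ?invr_ge0 ?exprn_ge0.
  - move=> S S' /andP[/andP[SF _] _] /andP[/andP[S'F _] _] E.
    by rewrite -(closed_setsK SF) -(closed_setsK S'F) -!/(T _) E.
  rewrite inE => /andP[/andP[/and3P[_ NB _] _] ->].
  rewrite andbT; apply: contraNneq NB => E.
  by rewrite -(finset.setCK (nbrs f S)) -/(T S) E finset.setC0.
rewrite mulr_sumr.
pose G S := p%:R ^+ n * \sum_(D : {set B} | eps * n%:R < #|D|%:R) (edgeless f S D)%:R : R.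
apply: (@le_trans _ _ (\sum_(S in closed_sets f | ~~ (#|S|%:R <= eps * n%:R) &&
    ~~ (#|T S|%:R <= eps * n%:R)) G S)).
  rewrite [leLHS](eq_bigl (fun S => (S \in closed_sets f) && (~~ (#|S|%:R <= eps * n%:R) &&
    ~~ (#|T S|%:R <= eps * n%:R)))); last by move=> S; rewrite andbA.
  apply: ler_sum => S /and3P[SF _]; rewrite -ltNge => TS.
  (* A weight is at most [p ^+ n], and the inner sum counts [T S], which is not joined to [S]. *)
  apply: le_trans (_ : p%:R ^+ n * 1 <= _).
    rewrite /weight ler_pM ?exprn_ge0 ?invr_ge0 ?exprn_ge0 //.
      by rewrite ler_weXn2l ?ler1n ?(ltnW p_gt1) // -cardA max_card.
    by rewrite invf_le1 ?exprn_gt0 // exprn_ege1 // ler1n ltnW.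
  rewrite ler_pM2l ?exprn_gt0 // (bigD1 (T S)) //= edgeless_nbrs subxx lerDl.
  by rewrite sumr_ge0.
apply: (@ler_sum_reindex _ _ _ id) => [S|? ? //|S].
  by rewrite mulr_ge0 ?exprn_ge0 // sumr_ge0.
by move=> /and3P[_ + _]; rewrite ltNge.
Qed.

(** There are at most [2^n * 2^n] pairs, each without edges with probability at most [(1 - |T| /
    n)^(|S| d) <= expR (- |S| |T| d / n)]. *)
Lemma mean_edgeless_le (eps : R) : 0 <= eps ->
  \sum_(f in Omega A B d) \sum_(S : {set A} | eps * n%:R < #|S|%:R)
    \sum_(T : {set B} | eps * n%:R < #|T|%:R) (edgeless f S T)%:R <=
  #|Omega A B d|%:R * (4 ^+ n * expR (- (eps ^+ 2 * n%:R * d%:R))) :> R.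
Proof.
move=> eps0; rewrite exchange_big /=; under eq_bigr do rewrite exchange_big /=.
have -> : (4 : R) ^+ n = 2 ^+ n * 2 ^+ n by rewrite -exprMn; congr (_ ^+ _); ring.
set c := expR _.
have termle S T : eps * n%:R < #|S|%:R -> eps * n%:R < #|T|%:R ->
    \sum_(f in Omega A B d) (edgeless f S T)%:R <= #|Omega A B d|%:R * c.
  move=> hS hT.
  have -> : \sum_(f in Omega A B d) (edgeless f S T)%:R =
      #|[set f in Omega A B d | edgeless f S T]|%:R :> R.
    rewrite -natr_sum -sum1_card; congr (_%:R).
    by rewrite [RHS](eq_bigl _ _ (in_set _)) big_mkcondr.
  apply: le_trans (card_edgeless_le R cardA cardB n_gt0 d_gt0 S T) _.
  rewrite ler_wpM2l //; apply: le_trans (exprD1_le_expR _ _) _.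
    by rewrite subr_ge0 ler_pdivrMr // mul1r ler_nat -cardB max_card.
  rewrite ler_expR mulrN lerN2 natrM.
  have -> : #|S|%:R * d%:R * (#|T|%:R / n%:R) = (#|S|%:R * #|T|%:R) * (d%:R / n%:R) :> R by ring.
  have -> : eps ^+ 2 * n%:R * d%:R = (eps * n%:R) * (eps * n%:R) * (d%:R / n%:R).
    by field; rewrite gt_eqF.
  by rewrite ler_wpM2r ?divr_ge0 // ler_pM ?mulr_ge0 ?(ltW n_gt0') // ltW.
have c0 : 0 <= #|Omega A B d|%:R * c by rewrite mulr_ge0 ?expR_ge0.
have sumT (D : finType) (P : pred {set D}) (F : {set D} -> R) (K : R) : #|D| = n -> 0 <= K ->
    (forall X, P X -> F X <= K) -> \sum_(X | P X) F X <= K * 2 ^+ n.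
  move=> cardD K0 FK; apply: le_trans (ler_sum _ FK) _.
  rewrite sumr_const -[leLHS]mulr_natr ler_wpM2l //.
  rewrite -natrX ler_nat -cardD -[#|D|]cardsT -card_powerset.
  by apply: subset_leq_card; apply/subsetP => X _; rewrite inE finset.subsetT.
have -> : #|Omega A B d|%:R * (2 ^+ n * 2 ^+ n * c) =
  #|Omega A B d|%:R * c * 2 ^+ n * 2 ^+ n by ring.
apply: (sumT) => // [|S hS]; first by rewrite mulr_ge0 // exprn_ge0.
by apply: sumT => // T; apply: termle.
Qed.

Lemma mean_cval_le (eps x : R) : 0 <= eps -> 0 < x -> x <= 1 ->
  \sum_(f in Omega A B d) cval R p (G := phi f) (lside A B) (rside A B) <=
  #|Omega A B d|%:R *
  (2 * ((expR (n%:R * (p%:R * (p%:R ^- d * expR 1))) - 1) +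
    expR (n%:R * (expR 1 * (p%:R * (2 / 3) ^+ d)) - n%:R / (2 * p%:R * d%:R ^+ 2)) +
    expR (n%:R * (x + eps * ln (p%:R / x))) * (2 / 3) ^+ (n %/ (8 * p))) +
   p%:R ^+ n * (4 ^+ n * expR (- (eps ^+ 2 * n%:R * d%:R)))).
Proof.
move=> eps0 x0 x1; apply: le_trans (ler_sum _ (fun f _ => cval_le f eps)) _.
set X := (_ - 1 + _ + _); rewrite !big_split /=.
rewrite mulrDr [2 * X]mulrDl mul1r [_ * (X + X)]mulrDr -mulr_sumr !lerD //.
- apply: le_trans (_ : #|Omega A B d|%:R * \sum_(S : {set A} | (S != finset.set0) &&
      (#|S|%:R <= eps * n%:R)) p%:R ^+ #|S| * mean_weight R p B (#|S| * d) <= _).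
    rewrite exchange_big mulr_sumr; apply: ler_sum => S _; rewrite -mulr_sumr mulrCA.
    by rewrite ler_wpM2l ?exprn_ge0 // (mean_nbrs_le R cardA cardB) // ltnW.
  by rewrite ler_wpM2l // small_sum_le.
- apply: le_trans (_ : #|Omega A B d|%:R * \sum_(T : {set B} | (T != finset.set0) &&
      (#|T|%:R <= eps * n%:R)) p%:R ^+ #|T| * mean_weight R p A (#|T| * d) <= _).
    rewrite exchange_big mulr_sumr; apply: ler_sum => T _; rewrite -mulr_sumr mulrCA.
    by rewrite ler_wpM2l ?exprn_ge0 // (mean_conbrs_le R cardA cardB) // ltnW.
  by rewrite ler_wpM2l // small_sum_le.
by rewrite mulrCA ler_wpM2l ?exprn_ge0 // mean_edgeless_le.
Qed.

Lemma cval_ge0 f : 0 <= cval R p (G := phi f) (lside A B) (rside A B).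
Proof. by rewrite sumr_ge0 // => S _; rewrite exprz_ge0. Qed.

End ClosedSets.

(** * Numerical estimates for the bound on the mean *)

Section Asymptotics.
Variable R : realType.
Implicit Types (eta : R) (p d n : nat).

Lemma expRN_le (a eta : R) : 0 < eta -> eta^-1 <= a -> expR (- a) <= eta.
Proof.
move=> eta0 ha; rewrite expRN -[leRHS]invrK lef_pV2 ?posrE ?invr_gt0 ?expR_gt0 //.
by apply: le_trans ha _; apply: le_trans (expR_ge1Dx a); rewrite lerDr.
Qed.

Lemma two_thirds_le : 2 / 3 <= expR (- (1 / 3)) :> R.
Proof. by apply: le_trans (expR_ge1Dx _); lra. Qed.

Lemma two_thirdsX_le (k : nat) : (2 / 3) ^+ k <= expR (- (k%:R / 3)) :> R.
Proof.
have -> : - (k%:R / 3) = k%:R * - (1 / 3) :> R by ring.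
rewrite expRM_natl lerXn2r ?nnegrE ?expR_ge0 ?two_thirds_le //; lra.
Qed.

(** The cube of [a / 3 <= expR (a / 3)]; a third power suffices to beat the squares of the degree
    met below. *)
Lemma expR_ge_cube (a : R) : 0 <= a -> (a / 3) ^+ 3 <= expR a.
Proof.
move=> a0; have -> : expR a = expR (a / 3) ^+ 3.
  by rewrite -expRM_natl; congr expR; field.
rewrite lerXn2r ?nnegrE ?expR_ge0 ?divr_ge0 //.
by apply: le_trans (expR_ge1Dx _); rewrite lerDr.
Qed.

(* With [x = 1/(96 p)], this makes [n (x + cutoff p * ln (p / x)) = n / (48 p)],
   half of the decay [n / (24 p)] coming from [(2 / 3) ^+ (n %/ (8 * p))]. *)
Definition cutoff p : R := (96 * p%:R)^-1 / ln (p%:R / (96 * p%:R)^-1).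

(** Each of the four terms is at most [eta] and three of them are doubled, whence [7 * eta]. *)
Lemma tail_bound_le p d n eta : (1 < p)%N -> (0 < n)%N -> (0 < d)%N -> 0 < eta ->
  n%:R * p%:R ^- d * (p%:R * expR 1) <= 1 / 2 :> R ->
  n%:R * p%:R ^- d * (p%:R * expR 1) <= eta / 2 ->
  2916 * expR 1 * p%:R ^+ 2 <= d%:R :> R ->
  4 * p%:R / eta * d%:R ^+ 2 <= n%:R ->
  4 * p%:R + 1 <= cutoff p ^+ 2 * d%:R ->
  48 * p%:R * (eta^-1 + 1) <= n%:R ->
  2 * ((expR (n%:R * (p%:R * (p%:R ^- d * expR 1))) - 1) +
    expR (n%:R * (expR 1 * (p%:R * (2 / 3) ^+ d)) - n%:R / (2 * p%:R * d%:R ^+ 2)) +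
    expR (n%:R * ((96 * p%:R)^-1 + cutoff p * ln (p%:R / (96 * p%:R)^-1))) *
      (2 / 3) ^+ (n %/ (8 * p))) +
   p%:R ^+ n * (4 ^+ n * expR (- (cutoff p ^+ 2 * n%:R * d%:R))) <= 7 * eta.
Proof.
move=> p1 n0 d0 eta0 h1 h1' h2 h3 h4 h5.
have p0 : 0 < p%:R :> R by rewrite ltr0n ltnW.
have p2 : 2 <= p%:R :> R by rewrite ler_nat.
have n0' : 0 < n%:R :> R by rewrite ltr0n.
have d0' : 0 < d%:R :> R by rewrite ltr0n.
have etai : 0 < eta^-1 by rewrite invr_gt0.
have X1 : expR (n%:R * (p%:R * (p%:R ^- d * expR 1))) - 1 <= eta.
  move: h1 h1'; set u := n%:R * p%:R ^- d * _ => u1 u2.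
  have -> : n%:R * (p%:R * (p%:R ^- d * expR 1)) = u by rewrite /u; ring.
  have u0 : 0 <= u by rewrite !mulr_ge0 ?invr_ge0 ?exprn_ge0 ?expR_ge0 ?(ltW p0).
  by have := expR_le_quadratic u0 u1; nra.
have X2 : expR (n%:R * (expR 1 * (p%:R * (2 / 3) ^+ d)) - n%:R / (2 * p%:R * d%:R ^+ 2)) <= eta.
  (* [v] is half of the subtracted term: one half absorbs the positive term, the other gives the
     decay. *)
  pose v : R := n%:R / (4 * p%:R * d%:R ^+ 2).
  apply: (@le_trans _ _ (expR (- v))); last first.
    apply: expRN_le => //; rewrite /v ler_pdivlMr ?mulr_gt0 ?exprn_gt0 //.
    by apply: le_trans h3; rewrite le_eqVlt; apply/orP; left; apply/eqP; ring.
  rewrite ler_expR.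
  have -> : n%:R / (2 * p%:R * d%:R ^+ 2) = v + v.
    by rewrite /v; field; rewrite !gt_eqF.
  suff : n%:R * (expR 1 * (p%:R * (2 / 3) ^+ d)) <= v by lra.
  (* [(2 / 3)^d <= expR (- d / 3) <= (d / 9)^(-3)], and the constant of the hypothesis is
     [2916 = 4 * 9^3]. *)
  rewrite ler_wpM2l //; apply: (@le_trans _ _ (expR 1 * (p%:R * ((d%:R / 9) ^+ 3)^-1))).
    rewrite !ler_pM2l ?expR_gt0 //; apply: le_trans (two_thirdsX_le d) _.
    rewrite expRN lef_pV2 ?posrE ?expR_gt0 ?exprn_gt0 ?divr_gt0 //.
    have -> : d%:R / 9 = (d%:R / 3) / 3 :> R by field.
    by rewrite expR_ge_cube ?divr_ge0.
  have -> : expR 1 * (p%:R * ((d%:R / 9) ^+ 3)^-1) =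
      (2916 * expR 1 * p%:R ^+ 2) / (4 * p%:R * d%:R ^+ 3) :> R.
    by field; rewrite !gt_eqF.
  rewrite ler_pdivrMr ?mulr_gt0 ?exprn_gt0 //.
  by have -> : (4 * p%:R * d%:R ^+ 2)^-1 * (4 * p%:R * d%:R ^+ 3) = d%:R :> R
    by field; rewrite !gt_eqF.
have X3 : expR (n%:R * ((96 * p%:R)^-1 + cutoff p * ln (p%:R / (96 * p%:R)^-1))) *
    (2 / 3) ^+ (n %/ (8 * p)) <= eta.
  have ln0 : 0 < ln (p%:R / (96 * p%:R)^-1) :> R.
    by rewrite ln_gt0 // invrK; nra.
  rewrite /cutoff divfK ?gt_eqF //.
  set K := (n %/ (8 * p))%N.
  apply: le_trans (ler_wpM2l (expR_ge0 _) (two_thirdsX_le K)) _.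
  rewrite -expRD; set w := _ - _ / 3.
  have : n%:R <= 8 * p%:R * (K%:R + 1) :> R.
    have : (n <= 8 * p * (K + 1))%N.
      by rewrite addn1 mulnC; apply: ltnW; rewrite -ltn_divLR ?muln_gt0 ?(ltnW p1).
    by rewrite -(ler_nat R) !natrM natrD.
  move=> hK; rewrite -[w]opprK; apply: expRN_le => //.
  rewrite /w opprB.
  have -> : K%:R / 3 - n%:R * ((96 * p%:R)^-1 + (96 * p%:R)^-1) =
     K%:R / 3 - n%:R / (48 * p%:R) :> R by field; rewrite gt_eqF.
  have : n%:R / (8 * p%:R) <= K%:R + 1 :> R by rewrite ler_pdivrMr ?mulr_gt0 // mulrC.
  have : eta^-1 + 1 <= n%:R / (48 * p%:R) by rewrite ler_pdivlMr ?mulr_gt0 // mulrC.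
  have -> : n%:R / (8 * p%:R) = 6 * (n%:R / (48 * p%:R)) :> R by field; rewrite gt_eqF.
  by lra.
have X4 : p%:R ^+ n * (4 ^+ n * expR (- (cutoff p ^+ 2 * n%:R * d%:R))) <= eta.
  have -> : - (cutoff p ^+ 2 * n%:R * d%:R) = n%:R * - (cutoff p ^+ 2 * d%:R) by ring.
  (* The base of the [n]-th power is at most [expR (-1)], as [4 p <= expR (4 p)] and
     [cutoff p ^+ 2 * d >= 4 p + 1]. *)
  rewrite expRM_natl -!exprMn; apply: (@le_trans _ _ (expR (- n%:R))); last first.
    apply: expRN_le => //; apply: le_trans h5; nra.
  have -> : - n%:R = n%:R * -1 :> R by ring.
  rewrite expRM_natl lerXn2r ?nnegrE ?mulr_ge0 ?expR_ge0 ?(ltW p0) //.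
  rewrite mulrA; apply: (@le_trans _ _ (expR (4 * p%:R) * expR (- (cutoff p ^+ 2 * d%:R)))).
    rewrite ler_wpM2r ?expR_ge0 //; apply: le_trans (expR_ge1Dx _); lra.
  by rewrite -expRD ler_expR; lra.
by lra.
Qed.

End Asymptotics.

(** * Markov's inequality for the uniform measure *)

Lemma unif_prob_markov (R : realType) (T : finType) (O : {set T}) (X : T -> R) (delta c : R) :
  0 < delta -> (forall x, 0 <= X x) -> (0 < #|O|)%N ->
  \sum_(x in O) X x <= #|O|%:R * c ->
  1 - c / delta <= unif_prob R O (fun x => X x < delta).
Proof.
move=> delta0 X0 O0 sumX; have O0' : 0 < #|O|%:R :> R by rewrite ltr0n.
rewrite /unif_prob ler_pdivlMr //.
have split : #|[set x in O | X x < delta]|%:R +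
    #|[set x in O | ~~ (X x < delta)]|%:R = #|O|%:R :> R.
  rewrite -natrD -(cardsID [set x | X x < delta] O); congr (_ + _)%:R.
    by apply: eq_card => x; rewrite !inE.
  by apply: eq_card => x; rewrite !inE andbC.
have markov : delta * #|[set x in O | ~~ (X x < delta)]|%:R <= \sum_(x in O) X x.
  rewrite mulr_natr -sumr_const (eq_bigl _ _ (in_set _)) big_mkcondr /=.
  by apply: ler_sum => x _; case: ifPn; rewrite -?leNgt.
have bad := le_trans markov sumX; rewrite -ler_pdivlMl // in bad.
have -> : (1 - c / delta) * #|O|%:R = #|O|%:R - delta^-1 * (#|O|%:R * c) by ring.
by lra.
Qed.

From mathcomp Require Import classical_sets.
Import numFieldNormedType.Exports.
Local Open Scope classical_set_scope.
Local Open Scope ring_scope.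

(** * Consequences of the two growth conditions on the degree *)

Section DegreeGrowth.
Variables (R : realType) (p : nat) (t : nat -> nat).
Hypotheses (p_gt1 : (1 < p)%N)
  (t_lt : \forall n \near \oo, ((t n)%:R : R) < logb p (n%:R : R) + ln (ln (n%:R : R)))
  (t_lim : (((t n)%:R : R) - logb p (n%:R : R) @[n --> \oo] --> +oo)).

Let ln_ge_half : 1 / 2 <= ln p%:R :> R.
Proof.
rewrite -[leLHS]expRK ler_ln ?posrE ?expR_gt0 ?ltr0n ?(ltnW p_gt1) //.
apply: le_trans (_ : 2 <= _); last by rewrite ler_nat.
by have := @expR_le_quadratic R (1 / 2); lra.
Qed.

Lemma ln_natr_near (c : R) : \forall n \near \oo, c <= ln (n%:R : R).
Proof.
near=> n; have n0 : (0 : R) < n%:R.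
  by rewrite ltr0n; near: n; exists 1%N.
rewrite -[leLHS]expRK ler_ln ?posrE ?expR_gt0 //.
by near: n; exact: nbhs_infty_ger.
Unshelve. all: by end_near. Qed.

Lemma degree_near (c : R) : \forall n \near \oo, c <= (t n)%:R.
Proof.
have /cvgryPge/(_ c) := t_lim; apply: filterS2 (ln_natr_near 0) => n l0 h.
apply: le_trans h _; rewrite gerBl /logb divr_ge0 //.
by apply: le_trans ln_ge_half; lra.
Qed.

(** The left side is [p] to the power [- (t n - logb p n)], whose exponent tends to minus
    infinity. *)
Lemma natr_mul_pexpN_near (c : R) : 0 < c ->
  \forall n \near \oo, n%:R * p%:R ^- t n <= c.
Proof.
move=> c0; have p0 : 0 < p%:R :> R by rewrite ltr0n ltnW.
have lnp0 : 0 < ln p%:R :> R by apply: lt_le_trans ln_ge_half; lra.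
have /cvgryPge/(_ (- ln c / ln p%:R)) t_near := t_lim.
near=> n; have h : - ln c / ln p%:R <= (t n)%:R - logb p (n%:R : R) by near: n.
have n0 : (0 : R) < n%:R.
  by rewrite ltr0n; near: n; exists 1%N.
rewrite -[n%:R]lnK ?posrE // -[p%:R]lnK ?posrE // -expRM_natl -expRN -expRD.
rewrite -[leRHS]lnK ?posrE // ler_expR.
move: h; rewrite ler_pdivrMr // mulrBl /logb divfK ?gt_eqF //; lra.
Unshelve. all: by end_near. Qed.

(** The upper bound on the degree gives [t n <= 3 ln n], whereas [n >= (ln n / 3)^3]. *)
Lemma degree_sqr_near (c : R) : \forall n \near \oo, c * (t n)%:R ^+ 2 <= n%:R.
Proof.
near=> n; have n0 : (0 : R) < n%:R.
  by rewrite ltr0n; near: n; exists 1%N.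
have L0 : 1 <= ln (n%:R : R) by near: n; exact: ln_natr_near.
(* [243 = 9 * 27] turns [|c| (3 L)^2 <= (L / 3)^3] into a lower bound on [L]. *)
have Lc : 243 * `|c| <= ln (n%:R : R) by near: n; exact: ln_natr_near.
have : (t n)%:R < logb p (n%:R : R) + ln (ln (n%:R : R)) by near: n; exact: t_lt.
set L := ln (n%:R : R) in L0 Lc * => t_ltn.
have tL : (t n)%:R <= 3 * L.
  have : ln L < L by rewrite ln_sublinear //; lra.
  have : logb p (n%:R : R) <= 2 * L.
    rewrite /logb ler_pdivrMr; first by have := ln_ge_half; rewrite -/L; nra.
    by apply: lt_le_trans ln_ge_half; lra.
  lra.
have nL : (L / 3) ^+ 3 <= n%:R.
  by rewrite -[leRHS]lnK ?posrE // expR_ge_cube //; lra.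
apply: le_trans nL; apply: (@le_trans _ _ (`|c| * (3 * L) ^+ 2)).
  apply: le_trans (ler_wpM2r (sqr_ge0 _) (ler_norm c)) _.
  by rewrite ler_wpM2l // !expr2 ler_pM.
have -> : `|c| * (3 * L) ^+ 2 = (243 * `|c|) * (L ^+ 2 / 27) by field.
have -> : (L / 3) ^+ 3 = L * (L ^+ 2 / 27) by field.
by rewrite ler_wpM2r // divr_ge0 ?sqr_ge0.
Unshelve. all: by end_near. Qed.

End DegreeGrowth.

(** * Choice of the constants and combination of the bounds *)

Theorem theorem5p3 (R : realType) (p : nat) (t : nat -> nat)
  (A B : nat -> finType)
  (hp : prime p)
  (t_gt0 : forall n : nat, (0 < n)%N -> (0 < t n)%N)
  (t_lt : \forall n \near \oo,
     ((t n)%:R : R) < logb p (n%:R : R) + ln (ln (n%:R : R)))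
  (t_lim : ((t n)%:R : R) - logb p (n%:R : R) @[n --> \oo] --> +oo)
  (cardA : forall n : nat, (0 < n)%N -> #|A n| = n)
  (cardB : forall n : nat, (0 < n)%N -> #|B n| = n) :
  forall delta : R, 0 < delta ->
  exists n0 : nat, forall n : nat, (n0 <= n)%N ->
    unif_prob R (Omega (A n) (B n) (t n))
      (fun f => cval R p (G := phi f) (lside (A n) (B n)) (rside (A n) (B n))
                < delta)
    >= 9 / 10.
Proof.
move=> delta delta0; have p_gt1 := prime_gt1 hp.
have p0 : 0 < p%:R :> R by rewrite ltr0n ltnW.
have p2 : 2 <= p%:R :> R by rewrite ler_nat.
(* Then [7 * eta / delta = 1 / 10], the failure probability allowed in Markov's inequality. *)
pose eta := delta / 70; have eta0 : 0 < eta by rewrite divr_gt0.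
pose eps := cutoff R p.
have x0 : 0 < (96 * p%:R)^-1 :> R by rewrite invr_gt0 mulr_gt0.
have x1 : (96 * p%:R)^-1 <= 1 :> R by rewrite invf_le1 ?mulr_gt0 //; lra.
have eps0 : 0 < eps.
  by rewrite /eps /cutoff divr_gt0 // ln_gt0 // invrK; nra.
pose c : R := p%:R * expR 1; have c0 : 0 < c by rewrite mulr_gt0 ?expR_gt0.
suff [n0 _ main] : \forall n \near \oo,
    9 / 10 <= unif_prob R (Omega (A n) (B n) (t n))
      (fun f => cval R p (G := phi f) (lside (A n) (B n)) (rside (A n) (B n)) < delta).
  by exists n0.
near=> n; have n_gt0 : (0 < n)%N by near: n; exists 1%N.
have d_gt0 := t_gt0 n n_gt0.
have cA := cardA n n_gt0; have cB := cardB n n_gt0.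
have h1 : n%:R * p%:R ^- t n <= 1 / 2 / c.
  near: n; apply: (natr_mul_pexpN_near p_gt1 t_lim) => //; rewrite divr_gt0 //; lra.
have h1' : n%:R * p%:R ^- t n <= eta / 2 / c.
  near: n; apply: (natr_mul_pexpN_near p_gt1 t_lim) => //; rewrite divr_gt0 //; lra.
have h2 : 2916 * expR 1 * p%:R ^+ 2 <= (t n)%:R :> R.
  by near: n; exact: (degree_near p_gt1 t_lim).
have h3 : 4 * p%:R / eta * (t n)%:R ^+ 2 <= n%:R.
  by near: n; exact: (degree_sqr_near p_gt1 t_lt).
have h4 : (4 * p%:R + 1) / eps ^+ 2 <= (t n)%:R :> R.
  by near: n; exact: (degree_near p_gt1 t_lim).
have h5 : 48 * p%:R * (eta^-1 + 1) <= n%:R by near: n; exact: nbhs_infty_ger.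
rewrite ler_pdivlMr // in h1; rewrite ler_pdivlMr // in h1'.
rewrite ler_pdivrMr ?exprn_gt0 // [leRHS]mulrC in h4.
have tail := tail_bound_le p_gt1 n_gt0 d_gt0 eta0 h1 h1' h2 h3 h4 h5.
have mean := mean_cval_le cA cB n_gt0 d_gt0 p_gt1 (ltW eps0) x0 x1.
apply: le_trans (unif_prob_markov delta0 _ _ (le_trans mean (ler_wpM2l _ tail))) => //.
- by rewrite /eta [leRHS](_ : _ = 9 / 10) //; field; rewrite gt_eqF.
- by move=> f; apply: cval_ge0.
- exact: (Omega_gt0 (t n) cA cB).
Unshelve. all: by end_near. Qed.
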